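(* (Dual property of dual-horizon.) Let $\Omega$ be the domain of a body in which each point $\mathbf x$ has a horizon $H_{\mathbf x}$ and a dual-horizon $H'_{\mathbf x}=\{\mathbf x' : \mathbf x\in H_{\mathbf x'}\}$, and let $\mathcal F(\mathbf x,\mathbf x')$ be any expression depending on the bond $\mathbf x\mathbf x'$. Then the double summation (integration) of $\mathcal F(\mathbf x,\mathbf x')$ over dual-horizons can be converted to the double summation (integration) of $\mathcal F(\mathbf x',\mathbf x)$ over horizons: (i) Discrete form. If $\Omega$ is discretized into finitely many cells, each represented by a material point $\mathbf x$ with associated volume $\Delta V_{\mathbf x}$, then $$\sum_{\Omega}\Big(\sum_{H'_{\mathbf x}}\mathcal F(\mathbf x,\mathbf x')\,\Delta V_{\mathbf x'}\Big)\Delta V_{\mathbf x}=\sum_{\Omega}\Big(\sum_{H_{\mathbf x}}\mathcal F(\mathbf x',\mathbf x)\,\Delta V_{\mathbf x'}\Big)\Delta V_{\mathbf x},$$ where the outer sums run over all material points $\mathbf x$ of the discretization and the inner sums over the material points $\mathbf x'$ lying in $H'_{\mathbf x}$, respectively in $H_{\mathbf x}$. (ii) Continuum form. $$\int_\Omega\int_{H'_{\mathbf x}}\mathcal F(\mathbf x,\mathbf x')\,dV_{\mathbf x'}\,dV_{\mathbf x}=\int_\Omega\int_{H_{\mathbf x}}\mathcal F(\mathbf x',\mathbf x)\,dV_{\mathbf x'}\,dV_{\mathbf x}.$$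
   Context: In dual-horizon peridynamics each material point $\mathbf x$ of a body $\Omega$ has a horizon $H_{\mathbf x}$, the domain such that any material point $\mathbf x'$ falling inside it forms a bond $\mathbf x\mathbf x'$ (directed from $\mathbf x$ to $\mathbf x'$, so $\mathbf x\mathbf x'$ and $\mathbf x'\mathbf x$ are distinguished). Horizons may vary from point to point, so $\mathbf x'\in H_{\mathbf x}$ does not imply $\mathbf x\in H_{\mathbf x'}$. The dual-horizon of $\mathbf x$ is the set of points whose horizons contain $\mathbf x$. $dV_{\mathbf x}$ and $dV_{\mathbf x'}$ denote volume elements at $\mathbf x$ and $\mathbf x'$. The continuum form is obtained from the discrete form as the limit in which the number of cells tends to infinity and the cell volumes tend to zero.
   Formalization: In the continuum form, the set of bonds (pairs x, x' with x' in the dual-horizon of x) is assumed measurable and F is assumed absolutely integrable over it, since for an arbitrary expression F the two double integrals can both exist and differ. *)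

(* Defs.v *)
From mathcomp Require Export all_boot all_order all_algebra.
From mathcomp Require Export all_classical all_reals all_analysis.

Set Implicit Arguments.
Unset Strict Implicit.
Unset Printing Implicit Defensive.

Import Order.TTheory GRing.Theory Num.Theory.

Local Open Scope classical_set_scope.
Local Open Scope ring_scope.

(* Only material points, i.e. points of the body Omega, form bonds.  H x may
   stick out of Omega (e.g. a ball centred near the boundary): the part of it
   outside Omega carries no material and is cut off. *)
Definition horizon (E : Type) (Omega : set E) (H : E -> set E) (x : E) :
  set E := Omega `&` H x.

Definition dual_horizon (E : Type) (Omega : set E) (H : E -> set E) (x : E) :
  set E := [set x' | Omega x' /\ horizon Omega H x' x].

(* The pairs (x, x') with x' in the dual-horizon of x. *)
Definition dual_bonds (E : Type) (Omega : set E) (H : E -> set E) :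
  set (E * E) := [set z | dual_horizon Omega H z.1 z.2].

(* Bond quantities are scalars (p = q = 1), vectors (q = 1) or tensors; they
   are integrated entrywise.  Each entry is a real-valued Lebesgue integral,
   meaningful when the entries of f are integrable on D. *)
Definition mxintegral (d : measure_display) (E : measurableType d)
    (R : realType) (mu : {measure set E -> \bar R}) (p q : nat)
    (D : set E) (f : E -> 'M[R]_(p, q)) : 'M[R]_(p, q) :=
  \matrix_(i, j) Rintegral mu D (fun x => f x i j).

Definition mxintegrable (d : measure_display) (E : measurableType d)
    (R : realType) (mu : {measure set E -> \bar R}) (p q : nat)
    (D : set E) (f : E -> 'M[R]_(p, q)) : Prop :=
  forall i j, mu.-integrable D (fun x => (f x i j)%:E).

(* Main.v *)
Require Import Defs.
From mathcomp Require Import measurable_realfun.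

Set Implicit Arguments.
Unset Strict Implicit.
Unset Printing Implicit Defensive.

Import Order.TTheory GRing.Theory Num.Theory.

Local Open Scope classical_set_scope.
Local Open Scope ring_scope.

(* Both sides integrate F over the same set of bonds: for x in Omega, the
   dual-horizon of x is the x-section of [dual_bonds] and the horizon of x is
   its y-section at x, while both sections are empty for x outside Omega.  So
   the two iterated integrals are the two orders of integration in Fubini's
   theorem. *)

(* [fine] sends infinite values to 0, which an integrable function takes only
   on a null set. *)
Lemma Rintegral_fine (d : measure_display) (T : measurableType d)
    (R : realType) (mu : {measure set T -> \bar R}) (g : T -> \bar R) :
  mu.-integrable setT g ->
  Rintegral mu setT (fine \o g) = fine (\int[mu]_x g x)%E.
Proof.
move=> ig; have mg := measurable_int _ ig.
rewrite /Rintegral; congr fine; apply: ae_eq_integral => //.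
  by apply/measurable_EFinP; exact: measurableT_comp.
by apply: filterS (integrable_ae measurableT ig) => x gx _ /=; rewrite fineK// gx.
Qed.

(** The absolute value of an inner integral is at most the inner integral of [abse \o f], whose
    outer integral is finite by Tonelli. *)
Lemma integrable_fubini_G (d1 d2 : measure_display) (T1 : measurableType d1)
    (T2 : measurableType d2) (R : realType)
    (m1 : {sigma_finite_measure set T1 -> \bar R})
    (m2 : {sigma_finite_measure set T2 -> \bar R}) (f : T1 * T2 -> \bar R) :
  (m1 \x m2)%E.-integrable setT f -> m2.-integrable setT (fubini_G m1 f).
Proof.
move=> intf; have mf := measurable_int _ intf.
have mG := measurable_fubini_G intf.
apply/integrableP; split => //.
apply: le_lt_trans ((integrable21ltyP m1 m2 mf).1 intf).
apply: ge0_le_integral => //.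
- exact: measurableT_comp.
- apply: (@measurable_fun_fubini_tonelli_G _ _ _ _ _ m1 (abse \o f) _ _).
    exact: measurableT_comp.
  by move=> z; exact: abse_ge0.
- by move=> y _; apply: le_abse_integral => //; exact: measurableT_comp.
Qed.

Section Rintegral_fubini.
Context (d1 d2 : measure_display) (T1 : measurableType d1)
  (T2 : measurableType d2) (R : realType).
Variables (m1 : {sigma_finite_measure set T1 -> \bar R})
  (m2 : {sigma_finite_measure set T2 -> \bar R}).
Variables (D : set (T1 * T2)) (f : T1 * T2 -> R).
Hypotheses (mD : measurable D)
  (intf : (m1 \x m2)%E.-integrable D (EFin \o f)).

(** Extension by zero: Fubini on the whole product then yields inner integrals over the sections of
    [D]. *)
Let g : T1 * T2 -> \bar R := (EFin \o f) \_ D.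

Let intg : (m1 \x m2)%E.-integrable setT g.
Proof. exact: (integrable_mkcond _ mD).1. Qed.

Lemma Rintegral12_prod_meas :
  Rintegral m1 setT
    (fun x => Rintegral m2 (xsection D x) (fun y => f (x, y)))
  = Rintegral (m1 \x m2)%E D f.
Proof.
rewrite [RHS]/Rintegral integral_mkcond -(integral12_prod_meas1 intg).
(* Moves [fine] inside the outer integral, to match the inner [Rintegral] on the left. *)
rewrite -(Rintegral_fine (integrable_fubini_F intg)).
congr Rintegral; apply/funext => x /=.
rewrite /Rintegral integral_mkcond /fubini_F; congr fine.
by apply: eq_integral => y _; rewrite /g /patch mem_xsection.
Qed.

Lemma Rintegral21_prod_meas :
  Rintegral m2 setT
    (fun y => Rintegral m1 (ysection D y) (fun x => f (x, y)))
  = Rintegral (m1 \x m2)%E D f.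
Proof.
rewrite [RHS]/Rintegral integral_mkcond -(integral21_prod_meas1 intg).
rewrite -(Rintegral_fine (integrable_fubini_G intg)).
congr Rintegral; apply/funext => y /=.
rewrite /Rintegral integral_mkcond /fubini_G; congr fine.
by apply: eq_integral => x _; rewrite /g /patch mem_ysection.
Qed.

End Rintegral_fubini.

Section dual_horizon_sections.
Context (E : Type) (Omega : set E) (H : E -> set E).

Lemma in_dual_horizon (x x' : E) : Omega x -> Omega x' ->
  (x' \in dual_horizon Omega H x) = (x \in horizon Omega H x').
Proof.
move=> Ox Ox'; apply/idP/idP; rewrite !inE => -[]; first by [].
by move=> *; split; [|split].
Qed.

Lemma xsection_dual_bonds (x : E) :
  xsection (dual_bonds Omega H) x = dual_horizon Omega H x.
Proof. by apply/funext => x'; apply/propext; exact: xsectionP. Qed.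

Lemma xsection_dual_bonds0 (x : E) : ~ Omega x ->
  xsection (dual_bonds Omega H) x = set0.
Proof.
by move=> Ox; rewrite xsection_dual_bonds -subset0 => x' [_ []].
Qed.

(** For [x] outside [Omega] the section is empty, whereas [horizon Omega H x] may still contain
    points of the body. *)
Lemma ysection_dual_bonds (x : E) : Omega x ->
  ysection (dual_bonds Omega H) x = horizon Omega H x.
Proof.
move=> Ox; apply/seteqP; split => x'; first by move=> /ysectionP[_ []].
by move=> [Ox' Hxx']; apply/ysectionP.
Qed.

Lemma ysection_dual_bonds0 (x : E) : ~ Omega x ->
  ysection (dual_bonds Omega H) x = set0.
Proof.
by move=> Ox; rewrite -subset0 => x' /ysectionP[].
Qed.

End dual_horizon_sections.

(* E with its volume measure vol is the ambient space of the body: for R^3,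
   take E := R * R * R and vol the product of three Lebesgue measures. *)
Theorem mainTheorem1 (R : realType) (d : measure_display)
    (E : measurableType d) (vol : {sigma_finite_measure set E -> \bar R})
    (Omega : set E) (H : E -> set E)
    (p q : nat) (F : E -> E -> 'M[R]_(p, q)) :
  (* discrete form: the cells are indexed by I, cell k being represented by
     the material point pt k with associated volume dV k *)
  (forall (I : finType) (pt : I -> E) (dV : I -> R),
     (forall k, Omega (pt k)) ->
     \sum_k dV k *:
        (\sum_(l | pt l \in dual_horizon Omega H (pt k))
            dV l *: F (pt k) (pt l))
     = \sum_k dV k *:
        (\sum_(l | pt l \in horizon Omega H (pt k))
            dV l *: F (pt l) (pt k)))
  /\
  (* continuum form *)
  (measurable Omega ->
   measurable (dual_bonds Omega H) ->
   mxintegrable (vol \x vol)%E (dual_bonds Omega H) (fun z => F z.1 z.2) ->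
   mxintegral vol Omega (fun x =>
      mxintegral vol (dual_horizon Omega H x) (fun x' => F x x'))
   = mxintegral vol Omega (fun x =>
      mxintegral vol (horizon Omega H x) (fun x' => F x' x))).
Proof.
split=> [I pt dV Opt|_ mB intF].
  under eq_bigr do rewrite scaler_sumr.
  under [RHS]eq_bigr do rewrite scaler_sumr.
  (* After the exchange the outer index [l] plays the role of [k] on the right, so the arguments of
     [F] appear swapped. *)
  rewrite (exchange_big_dep xpredT)//=; apply: eq_bigr => l _.
  apply: eq_big => [k|k _]; first exact: in_dual_horizon.
  by rewrite !scalerA mulrC.
apply/matrixP => i j; rewrite !mxE.
under eq_Rintegral do rewrite mxE.
under [RHS]eq_Rintegral do rewrite mxE.
(* The outer integrands are extended by zero from [Omega] to all of [E], in agreement with the empty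
   sections there. *)
rewrite Rintegral_mkcond [RHS]Rintegral_mkcond.
transitivity (Rintegral (vol \x vol)%E (dual_bonds Omega H)
  (fun z => F z.1 z.2 i j)).
- rewrite -(Rintegral12_prod_meas mB (intF i j)).
  congr Rintegral; apply/funext => x; rewrite /patch.
  case: ifPn => [_|]; first by rewrite xsection_dual_bonds.
  by rewrite notin_setE => Ox; rewrite xsection_dual_bonds0// Rintegral_set0.
- rewrite -(Rintegral21_prod_meas mB (intF i j)).
  congr Rintegral; apply/funext => x; rewrite /patch.
  case: ifPn => [|]; first by rewrite inE => Ox; rewrite ysection_dual_bonds.
  by rewrite notin_setE => Ox; rewrite ysection_dual_bonds0// Rintegral_set0.
Qed.
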